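(* Let $0<\Gamma<1$ and $0<\alpha<1$, and run the algorithm confidentPFM with inputs $x_0,\Gamma,\alpha$. (a) The probability that confidentPFM makes no errors is at least $1-\alpha$. (b) If $0<\epsilon<M\,\mathrm{dist}(x_0,X_\Omega)$, then (for every sequence of samples) confidentPFM computes a value $\epsilon_k$ satisfying $\epsilon_k\le\epsilon$ within $$1+\left\lfloor\left(\frac{M\,\mathrm{dist}(x_0,X_\Omega)}{\epsilon}\right)^2\right\rfloor$$ iterations. (c) Let $0<\epsilon<M\,\mathrm{dist}(x_0,X_\Omega)$. Suppose that (1) the following Growth Assumption holds: there are constants $\mu>0$, $d\ge1$, $0<\Delta\le1$ such that for every $x\in\mathcal B\setminus X_\Omega$, $P\{\omega\in\Omega : f_\omega(x)\ge\mu\,\mathrm{dist}(x,X_\Omega)^d\}\ge\Delta$; (2) $\Gamma<\Delta$; and (3) confidentPFM makes no errors. Then the number of iterations within which confidentPFM computes a value $\epsilon_k$ satisfying $\epsilon_k\le\epsilon$ does not exceed $$5+4\left(\frac{M}{\mu^{1/d}\epsilon^{1-1/d}}\right)^2\min\left\{\frac{1}{4^{1-1/d}-1},\ \log_2\left(\frac{M\,\mathrm{dist}(x_0,X_\Omega)}{\epsilon}\right)\right\},$$ where for $d=1$ the quantity $\frac{1}{4^{1-1/d}-1}$ is interpreted as $+\infty$.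
   Context: Setting. $(\Omega,\mathcal F,P)$ is a probability space ($\Omega$ may be finite or infinite). For each $\omega\in\Omega$, $f_\omega:\mathbb{R}^n\to\mathbb{R}$ is a convex function. $\|\cdot\|$ is the Euclidean norm. All sets and maps whose probabilities are taken are understood to be measurable. Define $X_\Omega=\{x : f_\omega(x)\le 0 \text{ for all } \omega\in\Omega\}$, assumed nonempty, and let $\mathrm{dist}(x,X_\Omega)$ denote the Euclidean distance from $x$ to $X_\Omega$. For a point $x$ and a real number $\epsilon$ let $\Omega(x,\epsilon)=\{\omega\in\Omega : f_\omega(x)\le\epsilon\}$. Fix an initial point $x_0$; let $z_0$ be the point of $X_\Omega$ closest to $x_0$, and let $\mathcal B=\{x:\|x-z_0\|\le\|x_0-z_0\|\}$. It is assumed that, for every $\omega$, $f_\omega$ is $M$-Lipschitz (i.e. $|f_\omega(x)-f_\omega(y)|\le M\|x-y\|$) on an open neighborhood of $\mathcal B$. For each $\omega$ and $x$, $g_\omega(x)$ denotes a fixed element of the subdifferential $\partial f_\omega(x)$ (a fixed subgradient selection). Algorithm confidentPFM (input: $x_0$, $0<\Gamma<1$, and $0<\alpha<1$, the allowable probability of error). For $k=1,2,3,\dots$ (iteration $k$): (1) Compute $L=\left\lceil\frac1\Gamma\ln\left(\frac{2k^2}{\alpha}\right)\right\rceil$ and independently draw samples $\omega_{k,1},\dots,\omega_{k,L}$ from $(\Omega,\mathcal F,P)$ (with replacement, and independently of all earlier samples). (2) Let $\ell_k$ be an index maximizing $f_{\omega_{k,\ell}}(x_{k-1})$ over $\ell=1,\dots,L$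 (ties broken by a fixed rule) and let $\epsilon_{k-1}=f_{\omega_{k,\ell_k}}(x_{k-1})$. If $\epsilon_{k-1}\le 0$, set $x_k=x_{k-1}$; otherwise set $x_k=x_{k-1}-\frac{\epsilon_{k-1}}{\|g\|^2}\,g$ where $g=g_{\omega_{k,\ell_k}}(x_{k-1})$. Thus $\epsilon_k$ is computed in iteration $k+1$, so ''computes $\epsilon_k\le\epsilon$ within $N$ iterations'' means that $\epsilon_k\le\epsilon$ for some $k\ge 0$ with $k+1\le N$. An error occurs when a pair $(x_k,\epsilon_k)$, $k\ge0$, produced by the algorithm fails to satisfy $P(\Omega(x_k,\epsilon_k))\ge1-\Gamma$. The algorithm ''makes no errors'' if no error occurs for any $k\ge0$. Probability in (a) is over the random draws of all the samples $\omega_{k,\ell}$. *)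

(* Defs.v *)
From HB Require Import structures.
From mathcomp Require Import all_boot all_order all_algebra.
From mathcomp Require Import all_classical all_reals all_analysis.
Set Implicit Arguments.
Unset Strict Implicit.
Unset Printing Implicit Defensive.
Import Order.TTheory GRing.Theory Num.Theory.
Import numFieldNormedType.Exports.
Local Open Scope classical_set_scope.
Local Open Scope ring_scope.

(* Vectors of R^n are row vectors.  The library norm of ['rV[R]_n] is the sup
   norm, hence an explicit Euclidean norm; the two topologies coincide, so the
   library's [open] is used for neighborhoods and Borel sets. *)

Definition dotv (R : realType) (n : nat) (u v : 'rV[R]_n) : R :=
  \sum_(i < n) u 0 i * v 0 i.

Definition enorm (R : realType) (n : nat) (u : 'rV[R]_n) : R :=
  Num.sqrt (dotv u u).

Definition dist_to (R : realType) (n : nat) (x : 'rV[R]_n) (X : set 'rV[R]_n) : R :=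
  inf [set enorm (x - z) | z in X].

Definition is_closest_point (R : realType) (n : nat)
    (X : set 'rV[R]_n) (x z : 'rV[R]_n) : Prop :=
  X z /\ forall y, X y -> enorm (x - z) <= enorm (x - y).

Definition eball (R : realType) (n : nat) (c : 'rV[R]_n) (r : R) : set 'rV[R]_n :=
  [set x | enorm (x - c) <= r].

Definition elipschitz (R : realType) (n : nat) (M : R) (U : set 'rV[R]_n)
    (h : 'rV[R]_n -> R) : Prop :=
  forall x y, U x -> U y -> `|h x - h y| <= M * enorm (x - y).

Definition subdifferential (R : realType) (n : nat) (h : 'rV[R]_n -> R)
    (x : 'rV[R]_n) : set 'rV[R]_n :=
  [set v | forall y, h x + dotv v (y - x) <= h y].

Definition borel_rV (R : realType) (n : nat) :=
  g_sigma_algebraType (@open 'rV[R]_n).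

(* [J] is the set of indices that matter; nothing is required of the other
   members of the family. *)
Definition mutually_independent (R : realType) (d d' : measure_display)
    (W : measurableType d) (T : measurableType d') (Q : probability W R)
    (I : choiceType) (J : set I) (X : I -> W -> T) : Prop :=
  forall (s : seq I) (A : I -> set T),
    uniq s -> [set` s] `<=` J -> (forall i, measurable (A i)) ->
    Q (\bigcap_(i in [set` s]) (X i @^-1` A i))
      = (\prod_(i <- s) Q (X i @^-1` A i))%E.

Definition iid_with_law (R : realType) (d d' : measure_display)
    (W : measurableType d) (T : measurableType d') (Q : probability W R)
    (P : probability T R) (I : choiceType) (J : set I) (X : I -> W -> T) : Prop :=
  [/\ forall i, J i -> measurable_fun [set: W] (X i),
      forall i, J i ->
        forall A, measurable A -> Q (X i @^-1` A) = P A
    & mutually_independent Q J X].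

Definition feasible (R : realType) (n : nat) (T : Type)
    (f : T -> 'rV[R]_n -> R) : set 'rV[R]_n :=
  [set x | forall w, f w x <= 0].

Definition Omega_le (R : realType) (n : nat) (T : Type)
    (f : T -> 'rV[R]_n -> R) (x : 'rV[R]_n) (eps : R) : set T :=
  [set w | f w x <= eps].

(* The absolute value only converts the ceiling to [nat]: for [1 <= k] and
   [alpha], [Gamma] in (0, 1) the ceiling is positive. *)
Definition sample_size (R : realType) (Gamma alpha : R) (k : nat) : nat :=
  `|Num.ceil (Gamma^-1 * ln (2 * k%:R ^+ 2 / alpha))|%N.

(* [(k, l)] is the index of the [l]-th sample of iteration [k]; both are
   counted from 1. *)
Definition sample_indices (R : realType) (Gamma alpha : R) : set (nat * nat) :=
  [set kl | (1 <= kl.1)%N /\ (1 <= kl.2 <= sample_size Gamma alpha kl.1)%N].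

(* A tie-breaking rule picks an element of the (increasing) list of the
   maximizing indices. *)
Definition tie_rule (tie : seq nat -> nat) : Prop :=
  forall s, s != [::] -> tie s \in s.

Definition maximizers (R : realType) (n : nat) (T : Type)
    (f : T -> 'rV[R]_n -> R) (L : nat) (om : nat -> T) (x : 'rV[R]_n) : seq nat :=
  [seq l <- iota 1 L | all (fun j => f (om j) x <= f (om l) x) (iota 1 L)].

(* [s k l] is the [l]-th sample drawn in iteration [k]; [worst_sample] is the
   sample selected in iteration [k] when the current point is [x]. *)
Definition worst_sample (R : realType) (n : nat) (T : Type)
    (f : T -> 'rV[R]_n -> R) (tie : seq nat -> nat) (Gamma alpha : R)
    (s : nat -> nat -> T) (k : nat) (x : 'rV[R]_n) : T :=
  s k (tie (maximizers f (sample_size Gamma alpha k) (s k) x)).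

Fixpoint pfm_x (R : realType) (n : nat) (T : Type)
    (f : T -> 'rV[R]_n -> R) (g : T -> 'rV[R]_n -> 'rV[R]_n)
    (tie : seq nat -> nat) (x0 : 'rV[R]_n) (Gamma alpha : R)
    (s : nat -> nat -> T) (k : nat) : 'rV[R]_n :=
  if k is k'.+1 then
    let x := pfm_x f g tie x0 Gamma alpha s k' in
    let w := worst_sample f tie Gamma alpha s k x in
    if f w x <= 0 then x else x - (f w x / enorm (g w x) ^+ 2) *: g w x
  else x0.

(* [pfm_eps k] is computed in iteration [k.+1], from the samples of that
   iteration. *)
Definition pfm_eps (R : realType) (n : nat) (T : Type)
    (f : T -> 'rV[R]_n -> R) (g : T -> 'rV[R]_n -> 'rV[R]_n)
    (tie : seq nat -> nat) (x0 : 'rV[R]_n) (Gamma alpha : R)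
    (s : nat -> nat -> T) (k : nat) : R :=
  let x := pfm_x f g tie x0 Gamma alpha s k in
  f (worst_sample f tie Gamma alpha s k.+1 x) x.

Definition makes_no_errors (R : realType) (n : nat) (d : measure_display)
    (T : measurableType d) (P : probability T R)
    (f : T -> 'rV[R]_n -> R) (g : T -> 'rV[R]_n -> 'rV[R]_n)
    (tie : seq nat -> nat) (x0 : 'rV[R]_n) (Gamma alpha : R)
    (s : nat -> nat -> T) : Prop :=
  forall k : nat,
    ((1 - Gamma)%:E <=
     P (Omega_le f (pfm_x f g tie x0 Gamma alpha s k)
                   (pfm_eps f g tie x0 Gamma alpha s k)))%E.

Definition growth_assumption (R : realType) (n : nat) (d : measure_display)
    (T : measurableType d) (P : probability T R) (f : T -> 'rV[R]_n -> R)
    (B : set 'rV[R]_n) (mu p Delta : R) : Prop :=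
  [/\ 0 < mu, 1 <= p, 0 < Delta <= 1
    & forall x, (B `\` feasible f) x ->
        (Delta%:E <= P [set w | (mu * dist_to x (feasible f) `^ p <= f w x)%R])%E].

Definition log2 (R : realType) (x : R) : R := ln x / ln 2.

(* Main.v *)
Require Import Defs.
From HB Require Import structures.
From mathcomp Require Import all_boot all_order all_algebra.
From mathcomp Require Import all_classical all_reals all_analysis.
From mathcomp Require Import measurable_realfun.
From mathcomp Require Import ring lra.
Set Implicit Arguments.
Unset Strict Implicit.
Unset Printing Implicit Defensive.
Import Order.TTheory GRing.Theory Num.Theory.
Import numFieldNormedType.Exports.
Local Open Scope classical_set_scope.
Local Open Scope ring_scope.

(** Why the theorem holds.

    Parts (b) and (c) are deterministic.  If a step is taken from [x] along a
    subgradient [v] of [h], and [h z <= 0 < h x], the subgradient inequality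
    bounds [h x] by the inner product of [v] with [x - z], so the step to
    [x - (h x / |v|^2) v] lowers the squared distance to [z] by at least
    [(h x / |v|)^2], hence by [(h x / M)^2] when [|v| <= M] ([polyak_step]).
    With [z := z0] the iterates never leave the ball on which every function is
    [M]-Lipschitz, which is what bounds the subgradients by [M].  As the squared
    distance to the feasible set stays nonnegative, from a point at distance at
    most [r] a value [<= e] is met after at most [floor ((M r / e)^2)] further
    steps ([reach_within_dist]); from the initial point this is (b).

    For (c), makes-no-errors and the growth assumption concern events whose
    probabilities add up to more than 1, so the events meet and
    [mu * dist (x_k)^p <= eps_k] ([growth_of_no_errors]).  A small value of
    [eps_k] thus certifies a small distance.  Choose [I] with
    [2^I eps < M dist (x0) <= 2^(I+1) eps].  Reaching the level
    [2^I eps] takes at most 4 steps, and each passage from the level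
    [2^(i+1) eps] to the level [2^i eps] costs at most [4 K^2 q^(i+1)] steps,
    where [K = M / (mu^(1/p) eps^(1 - 1/p))] and [q = 4^-(1 - 1/p) <= 1]; summing over the [I] levels gives at most
    [4 K^2 / (4^(1 - 1/p) - 1)] by the geometric series, and at most [4 K^2 I],
    where [I < log2 (M dist (x0) / eps)].

    For (a), fix a point [x] and call a sample [w] bad for [x] when
    [P (f_. x <= f_w x) < 1 - Gamma].  Whatever the law of [f_. x], a sample is
    bad with probability at most [1 - Gamma] ([prob_low_values]), and an error
    at [x_k] forces all the samples of iteration [k+1] to be bad for [x_k].
    The point [x_k] depends only on earlier samples, so each new sample
    contributes a factor [1 - Gamma] ([fresh_sample_le]), and the choice of the
    sample size turns [(1 - Gamma)^L] into [alpha / (2 (k+1)^2)], which sums to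
    at most [alpha].

    The measurability needed for (a) is obtained from that of the subgradient
    selection: on the segment from [0] to [x] the function [f_w] is the limit of
    the Riemann sums of its subgradients ([subgradient_riemann_sum]), so
    [(w, x) |-> f_w x] is jointly measurable.  Measurability of the iterates is
    proved over an arbitrary measurable space, in order to apply it to the
    sigma-algebra generated by the earlier samples. *)

(** * Euclidean geometry of a subgradient step *)

Section Euclidean.
Variables (R : realType) (n : nat).
Implicit Types u v w x y z : 'rV[R]_n.

Lemma dotvC u v : dotv u v = dotv v u.
Proof. by apply: eq_bigr => i _; rewrite mulrC. Qed.

Lemma dotvDr u v w : dotv u (v + w) = dotv u v + dotv u w.
Proof. by rewrite -big_split; apply: eq_bigr => i _; rewrite mxE mulrDr. Qed.

Lemma dotvZr a u v : dotv u (a *: v) = a * dotv u v.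
Proof. by rewrite /dotv mulr_sumr; apply: eq_bigr => i _; rewrite mxE mulrCA. Qed.

Lemma dotvNr u v : dotv u (- v) = - dotv u v.
Proof. by rewrite -scaleN1r dotvZr mulN1r. Qed.

Lemma dotvv_ge0 u : 0 <= dotv u u.
Proof. by apply: sumr_ge0 => i _; rewrite -expr2 sqr_ge0. Qed.

Lemma dotvv_eq0 u : (dotv u u == 0) = (u == 0).
Proof.
apply/eqP/eqP => [/eqP|->]; last by apply: big1 => i _; rewrite mxE mul0r.
rewrite psumr_eq0 => [/allP u0|i _]; last by rewrite -expr2 sqr_ge0.
apply/rowP => i; rewrite mxE; apply/eqP.
by have := u0 i (mem_index_enum _); rewrite mulf_eq0 orbb.
Qed.

Lemma enorm_ge0 u : 0 <= enorm u.
Proof. exact: sqrtr_ge0. Qed.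

Lemma enorm_sqr u : enorm u ^+ 2 = dotv u u.
Proof. by rewrite sqr_sqrtr // dotvv_ge0. Qed.

Lemma enormZ a u : 0 <= a -> enorm (a *: u) = a * enorm u.
Proof.
move=> a0; rewrite /enorm dotvZr dotvC dotvZr mulrA -expr2 sqrtrM ?sqr_ge0 //.
by rewrite sqrtr_sqr ger0_norm.
Qed.

Lemma enormB u v : enorm (u - v) ^+ 2 = enorm u ^+ 2 - 2 * dotv v u + enorm v ^+ 2.
Proof.
rewrite !enorm_sqr dotvDr dotvNr dotvC dotvDr dotvNr (dotvC (u - v)) dotvDr dotvNr.
rewrite (dotvC u v); ring.
Qed.

(** Moving from [x] by [t v] raises [h] by at least [t |v|^2], whereas the
    Lipschitz bound allows at most [M t |v|]. *)
Lemma subgradient_norm_le (h : 'rV[R]_n -> R) (M : R) (U : set 'rV[R]_n) x v :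
  0 <= M -> open U -> U x -> elipschitz M U h -> subdifferential h x v ->
  enorm v <= M.
Proof.
move=> M0 oU Ux hU hv; have [->|v0] := eqVneq v 0.
  by rewrite -(scale0r 0) enormZ // mul0r.
have v_gt0 : 0 < enorm v.
  rewrite lt_neqAle enorm_ge0 andbT eq_sym -sqrf_eq0 enorm_sqr.
  by rewrite dotvv_eq0.
have [e /= e0 eU] : exists2 e : R, 0 < e & ball x e `<=` U.
  by apply/nbhs_ballP; exact: open_nbhs_nbhs (conj oU Ux).
(* The step is short enough for [x + t *: v] to stay in the sup-norm ball. *)
pose t := e / (`|v| + 1).
have nv : 0 < `|v| + 1 by rewrite ltr_wpDl.
have t0 : 0 < t by rewrite divr_gt0.
have Ut : U (x + t *: v).
  apply: eU; rewrite mx_norm_ball /ball_ /= opprD addrA subrr add0r normrN normrZ.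
  by rewrite gtr0_norm // mulrAC ltr_pdivrMr // ltr_pM2l // ltrDl.
have xt : x + t *: v - x = t *: v by rewrite addrAC subrr add0r.
have := hU _ _ Ut Ux; have := hv (x + t *: v); rewrite xt dotvZr enormZ ?(ltW t0) //.
rewrite -enorm_sqr => h1 h2.
have : t * enorm v ^+ 2 <= M * (t * enorm v).
  rewrite (le_trans _ h2) // (le_trans _ (ler_norm _)) // lerBrDl //.
by rewrite (mulrC M) -(mulrA t) ler_pM2l // expr2 ler_pM2l.
Qed.

(** The length of the step is the one that minimizes the upper bound on the
    squared distance to [z] given by the subgradient inequality. *)
Lemma polyak_step (h : 'rV[R]_n -> R) (M : R) x v z :
  h z <= 0 -> 0 < h x -> subdifferential h x v -> enorm v <= M ->
  enorm (x - (h x / enorm v ^+ 2) *: v - z) ^+ 2 <=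
    enorm (x - z) ^+ 2 - (h x / M) ^+ 2.
Proof.
move=> hz hx hv vM.
have hvxz : h x <= dotv v (x - z).
  have := hv z; rewrite -(opprB x z) dotvNr => /le_trans/(_ hz).
  by rewrite subr_le0.
have v0 : v != 0.
  apply: contraTneq hvxz => ->; rewrite -ltNge /dotv big1 // => i _.
  by rewrite mxE mul0r.
have v_gt0 : 0 < enorm v.
  rewrite lt_neqAle enorm_ge0 andbT eq_sym -sqrf_eq0 enorm_sqr.
  by rewrite dotvv_eq0.
set a := h x / _; have a0 : 0 <= a by rewrite divr_ge0 ?sqr_ge0 // ltW.
rewrite (addrAC x) (enormB (x - z)) enormZ // (dotvC (a *: v)) dotvZr dotvC.
have E : a * enorm v ^+ 2 = h x by rewrite /a divfK // sqrf_eq0 gt_eqF.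
have -> : (a * enorm v) ^+ 2 = a * h x by rewrite -E; ring.
have : (h x / M) ^+ 2 <= a * h x.
  have -> : a * h x = h x ^+ 2 / enorm v ^+ 2 by rewrite /a; ring.
  rewrite expr_div_n; apply: ler_wpM2l; first exact: sqr_ge0.
  have M0 := lt_le_trans v_gt0 vM.
  by rewrite lef_pV2 ?posrE ?exprn_gt0 // ler_pXn2r // nnegrE ltW.
have : a * h x <= a * dotv v (x - z) by rewrite ler_wpM2l.
lra.
Qed.

Lemma dist_to_ge0 (X : set 'rV[R]_n) x z : X z -> 0 <= dist_to x X.
Proof.
move=> Xz; apply: lb_le_inf; first by exists (enorm (x - z)), z.
by move=> _ [y _ <-]; exact: enorm_ge0.
Qed.

Lemma lipschitz_gt0 (X : set 'rV[R]_n) x z (eps M : R) :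
  is_closest_point X x z -> 0 < eps -> eps < M * dist_to x X -> 0 < M.
Proof.
move=> [Xz _] eps0 /(lt_trans eps0).
have := dist_to_ge0 x Xz.
by rewrite le_eqVlt => /predU1P[<-|d0]; rewrite ?mulr0 ?ltxx // pmulr_lgt0.
Qed.

End Euclidean.

(** * Iteration bounds for an arbitrary sequence of samples *)

Section Deterministic.
Variables (R : realType) (n : nat) (T : Type) (f : T -> 'rV[R]_n -> R).
Variables (g : T -> 'rV[R]_n -> 'rV[R]_n) (x0 z0 : 'rV[R]_n) (M : R).
Variables (tie : seq nat -> nat) (Gamma alpha : R) (s : nat -> nat -> T).
Hypothesis g_subgradient : forall w x, subdifferential (f w) x (g w x).
Hypothesis z0_closest : is_closest_point (feasible f) x0 z0.
Hypothesis f_lipschitz : forall w, exists U : set 'rV[R]_n,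
  [/\ open U, eball z0 (enorm (x0 - z0)) `<=` U & elipschitz M U (f w)].
Hypothesis M_gt0 : 0 < M.

Local Notation xk := (pfm_x f g tie x0 Gamma alpha s).
Local Notation ek := (pfm_eps f g tie x0 Gamma alpha s).
Local Notation dX x := (dist_to x (feasible f)).

Lemma pfm_descent z k : feasible f z ->
  eball z0 (enorm (x0 - z0)) (xk k) -> 0 < ek k ->
  enorm (xk k.+1 - z) ^+ 2 <= enorm (xk k - z) ^+ 2 - (ek k / M) ^+ 2.
Proof.
pose w := worst_sample f tie Gamma alpha s k.+1 (xk k).
move=> Xz xB; rewrite -/(f w (xk k)) => e0.
have -> : xk k.+1 =
    xk k - (f w (xk k) / enorm (g w (xk k)) ^+ 2) *: g w (xk k).
  by rewrite /= -/w leNgt e0.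
have [U [oU BU fU]] := f_lipschitz w.
apply: (polyak_step (Xz w) e0 (g_subgradient w _)).
exact: (subgradient_norm_le (ltW M_gt0) oU (BU _ xB) fU).
Qed.

(** Induction on [k]: the descent towards [z0], which keeps the next point in the
    ball, is itself available only at points of the ball. *)
Lemma pfm_in_ball k : eball z0 (enorm (x0 - z0)) (xk k).
Proof.
elim: k => [|k IH]; first exact: lexx.
have [e0|e0] := leP (ek k) 0.
  by rewrite /eball /mkset /=; move: e0; rewrite /pfm_eps => ->.
rewrite /eball /mkset -(@ler_pXn2r _ 2) // ?nnegrE ?enorm_ge0 //.
rewrite (le_trans (pfm_descent (proj1 z0_closest) IH e0)) //.
rewrite (@le_trans _ _ (enorm (xk k - z0) ^+ 2)) //; first by rewrite gerBl sqr_ge0.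
by rewrite ler_pXn2r // ?nnegrE ?enorm_ge0.
Qed.

(** As long as the values exceed [e], each step lowers the squared distance to
    [z] by [(e / M)^2]. *)
Lemma reach_from z k (e : R) N : feasible f z -> 0 < e ->
  enorm (xk k - z) ^+ 2 < N%:R * (e / M) ^+ 2 ->
  exists2 j, (j < N)%N & ek (k + j) <= e.
Proof.
move=> Xz e0 xN; apply: contrapT => nex.
have ekN j : (j < N)%N -> e < ek (k + j).
  by move=> jN; rewrite ltNge; apply/negP => ?; apply: nex; exists j.
have : enorm (xk (k + N) - z) ^+ 2 <= enorm (xk k - z) ^+ 2 - N%:R * (e / M) ^+ 2.
  have : (N <= N)%N by [].
  elim: {-2}N => [|j IH] jN; first by rewrite addn0 mul0r subr0.
  have ej := ekN j jN; rewrite addnS.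
  rewrite (le_trans (pfm_descent Xz (pfm_in_ball _) (lt_trans e0 ej))) //.
  have := IH (ltnW jN); rewrite -natr1 mulrDl mul1r.
  have : (e / M) ^+ 2 <= (ek (k + j) / M) ^+ 2.
    rewrite ler_pXn2r ?nnegrE ?divr_ge0 ?(ltW M_gt0) ?(ltW e0)
      ?(ltW (lt_trans e0 ej)) //.
    by rewrite ler_pM2r ?invr_gt0 // ltW.
  lra.
have := sqr_ge0 (enorm (xk (k + N) - z)); lra.
Qed.

(** The distance is an infimum: a feasible point is taken within a radius slightly
    above [r], close enough to [r] not to cost an additional step. *)
Lemma reach_within_dist k (e r : R) : 0 < e -> dX (xk k) <= r ->
  exists2 j, ek (k + j) <= e & j%:Z <= Num.floor ((M * r / e) ^+ 2).
Proof.
move=> e0 dr.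
have Xz0 := proj1 z0_closest.
have d0 := dist_to_ge0 (xk k) Xz0.
set y := (M * r / e) ^+ 2; have y0 : 0 <= y by exact: sqr_ge0.
pose N := `|Num.floor y|%N.+1.
have NE : (N%:Z = Num.floor y + 1)%R.
  by rewrite /N -addn1 PoszD gez0_abs // floor_ge0.
have yN : y < N%:R by have := floorD1_gt y; rewrite -NE.
(* [N] is the least integer above [y], so [r] can be enlarged strictly. *)
have [r1 rr1 r1N] : exists2 r1, r < r1 & r1 ^+ 2 <= N%:R * (e / M) ^+ 2.
  exists (Num.sqrt (N%:R) * (e / M)).
    rewrite -ltr_pdivrMr ?divr_gt0 // invf_div.
    have r0 := le_trans d0 dr; have [M0 e0'] := (ltW M_gt0, ltW e0).
    rewrite -(@ltr_pXn2r _ 2) ?nnegrE ?sqrtr_ge0 ?mulr_ge0 ?invr_ge0 //.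
    by rewrite sqr_sqrtr // mulrC mulrAC.
  by rewrite exprMn sqr_sqrtr.
have [_ [z Xz <-] zr] := @inf_lt R [set enorm (xk k - z) | z in feasible f] r1
  (ex_intro _ _ (ex_intro2 _ _ z0 Xz0 erefl)) (le_lt_trans dr rr1).
have zN : enorm (xk k - z) ^+ 2 < N%:R * (e / M) ^+ 2.
  apply: lt_le_trans r1N; rewrite ltr_pXn2r ?nnegrE ?enorm_ge0 //.
  exact: le_trans (enorm_ge0 _) (ltW zr).
have [j jN ej] := reach_from Xz e0 zN.
exists j => //; rewrite -ltzD1 -NE ltz_nat; exact: jN.
Qed.

Section Growth.
Variables (eps mu p : R).
Hypotheses (eps_gt0 : 0 < eps) (mu_gt0 : 0 < mu) (p_ge1 : 1 <= p).
Hypothesis eps_growth : forall k, ~ feasible f (xk k) ->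
  mu * dX (xk k) `^ p <= ek k.

Let K := M / (mu `^ (1 / p) * eps `^ (1 - 1 / p)).
Let q := (4 `^ (1 - 1 / p))^-1 : R.

(** A value at most [2^(i+1) eps] bounds the distance by
    [(2^(i+1) eps / mu)^(1/p)]; this is the cost of halving the value again. *)
Lemma level_cost i :
  (M * (2 ^+ i.+1 * eps / mu) `^ (1 / p) / (2 ^+ i * eps)) ^+ 2 =
  4 * K ^+ 2 * q ^+ i.+1.
Proof.
have p0 : 0 < p by exact: lt_le_trans p_ge1.
set a := 1 / p; rewrite /K /q -/a.
have two0 : 0 < 2 ^+ i.+1 :> R by rewrite exprn_gt0.
have -> : (2 ^+ i.+1 * eps / mu) `^ a = (2 ^+ i.+1) `^ a * eps `^ a / mu `^ a.
  rewrite !powRM ?mulr_ge0 ?invr_ge0 ?(ltW two0) ?(ltW eps_gt0) ?(ltW mu_gt0) //.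
  by rewrite -powR_inv1 ?(ltW mu_gt0) // powRAC powR_inv1 // powR_ge0.
(* The factor [2^(i+1) eps] is split into its powers [1/p] and [1 - 1/p]; the
   first one cancels against the bound on the distance. *)
have splitE (c : R) : 0 < c -> c = c `^ a * c `^ (1 - a).
  move=> c0; rewrite -powRD; last by rewrite (gt_eqF c0) implybT.
  by rewrite addrC subrK powRr1 // ltW.
have qE : (4 `^ (1 - a))^-1 ^+ i.+1 = ((2 ^+ i.+1) `^ (1 - a)) ^- 2.
  have -> : 4 = 2 * 2 :> R by ring.
  rewrite powRM // -expr2 exprVn -exprM mulnC exprM; congr (_ ^- 2).
  by rewrite -!powR_mulrn ?powR_ge0 // powRAC.
rewrite qE; have -> : 2 ^+ i * eps = 2 ^+ i.+1 * eps / 2.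
  by rewrite exprS; field.
rewrite {2}(splitE _ two0) {2}(splitE _ eps_gt0).
move: (powR_gt0 a two0) (powR_gt0 (1 - a) two0) (powR_gt0 a eps_gt0).
move: (powR_gt0 (1 - a) eps_gt0) (powR_gt0 a mu_gt0).
move: (_ `^ _) (_ `^ _) (_ `^ _) (_ `^ _) (_ `^ _).
move=> A B C D E A0 B0 C0 D0 E0; field.
by rewrite !gt_eqF.
Qed.

(** At a feasible iterate the value is nonpositive and nothing remains to be
    done; elsewhere the growth inequality bounds the distance. *)
Lemma reach_from_level i k : ek k <= 2 ^+ i * eps ->
  exists2 j, ek (k + j) <= eps & j%:R <= 4 * K ^+ 2 * \sum_(l < i) q ^+ l.+1.
Proof.
elim: i k => [|i IH] k eki.
  by exists 0%N; rewrite ?addn0 ?big_ord0 ?mulr0 // -(mul1r eps).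
have [Xk|nXk] := pselect (feasible f (xk k)).
  exists 0%N; last first.
    apply: mulr_ge0; first by rewrite mulr_ge0 ?sqr_ge0.
    apply: sumr_ge0 => l _.
    by rewrite exprn_ge0 // invr_ge0 powR_ge0.
  rewrite addn0 (le_trans _ (ltW eps_gt0)) //; exact: Xk.
have p0 : 0 < p by exact: lt_le_trans p_ge1.
have d0 := dist_to_ge0 (xk k) (proj1 z0_closest).
have dr : dX (xk k) <= (2 ^+ i.+1 * eps / mu) `^ (1 / p).
  have -> : dX (xk k) = (dX (xk k) `^ p) `^ (1 / p).
    by rewrite -powRrM mul1r divff ?gt_eqF // powRr1.
  apply: ge0_ler_powR; rewrite ?nnegrE ?divr_ge0 ?mulr_ge0 ?exprn_ge0 ?powR_ge0
    ?(ltW p0) ?(ltW mu_gt0) ?(ltW eps_gt0) //.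
  by rewrite ler_pdivlMr // mulrC (le_trans (eps_growth nXk)).
have e0 : 0 < 2 ^+ i * eps by rewrite mulr_gt0 ?exprn_gt0.
have [j ej jle] := reach_within_dist e0 dr.
have [j' ej' j'le] := IH _ ej; exists (j + j')%N; first by rewrite addnA.
rewrite natrD big_ord_recr /= mulrDr [leRHS]addrC lerD // -level_cost.
apply: le_trans (floor_le_tmp _).
by rewrite -(ler_int R) in jle; exact: jle.
Qed.

(** Aligning the levels with [eps] leaves a first level of ratio at most 2 between
    [M dist (x0)] and [2^I eps]: it accounts for 4 of the 5 additive iterations,
    and the fifth one is the iteration that computes the final value. *)
Lemma reach_under_growth : eps < M * dX x0 ->
  exists k, ek k <= eps /\
    (k.+1%:R%:E <= 5%:E + (4 * K ^+ 2)%R%:E *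
       mine (if p == 1%R then +oo else (1 / (4 `^ (1 - 1 / p) - 1))%R%:E)
            (log2 (M * dX x0 / eps))%R%:E)%E.
Proof.
move=> epsD; set D := M * dX x0 / eps.
have D1 : 1 < D by rewrite ltr_pdivlMr // mul1r.
have [I ID DI] : exists2 I, 2 ^+ I < D & D <= 2 ^+ I.+1.
  have ex : exists i, D <= 2 ^+ i.
    exists `|Num.ceil D|%N.
    apply: le_trans (ceil_ge _) _.
    have -> : (Num.ceil D)%:~R = `|Num.ceil D|%N%:R :> R.
      by rewrite -[LHS](ger0_norm) ?natr_absz ?ler0z ?ceil_ge0 ?intr_norm //; lra.
    by rewrite -natrX ler_nat ltnW // ltn_expl.
  (* The least exponent is positive because [1 < D]. *)
  case: (ex_minnP ex) => [[|I]] DI minI.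
    by move: DI; rewrite expr0 leNgt D1.
  exists I => //; rewrite ltNge; apply/negP => /minI.
  by rewrite ltnn.
have ID2 : I%:R <= log2 D.
  rewrite /log2 ler_pdivlMr ?ln_gt0 ?ltr1n // mulr_natl -lnXn //.
  by rewrite ler_ln ?posrE ?exprn_gt0 ?(lt_trans _ D1) // ltW.
have e0 : 0 < 2 ^+ I * eps by rewrite mulr_gt0 ?exprn_gt0.
have [k0 ek0 k04] := reach_within_dist (k := 0) e0 (lexx _).
have [j ej jle] := reach_from_level ek0.
exists (k0 + j)%N; split; first by rewrite -[k0]add0n.
have k04' : k0%:R <= 4 :> R.
  rewrite -(ler_int R) in k04; apply: le_trans k04 _.
  apply: le_trans (floor_le_tmp _) _.
  have -> : M * dX x0 / (2 ^+ I * eps) = D / 2 ^+ I.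
    by rewrite /D; field; rewrite gt_eqF //= gt_eqF.
  have : D / 2 ^+ I <= 2 by rewrite ler_pdivrMr ?exprn_gt0 // -exprS.
  have : 0 <= D / 2 ^+ I by rewrite divr_ge0 ?exprn_ge0 // ltW // (lt_trans _ D1).
  by move=> ? ?; nra.
have K0 : 0 <= 4 * K ^+ 2 by rewrite mulr_ge0 ?sqr_ge0.
set S := \sum_(l < I) q ^+ l.+1 in jle.
have kS : (k0 + j).+1%:R <= 5 + 4 * K ^+ 2 * S.
  by rewrite -addn1 natrD natrD; lra.
have r_ge1 : 1 <= 4 `^ (1 - 1 / p).
  rewrite -[leLHS](powRr0 4) ler_powR ?ler1n // subr_ge0 ler_pdivrMr ?mul1r //.
  exact: lt_le_trans p_ge1.
have r_gt0 : 0 < 4 `^ (1 - 1 / p) by exact: lt_le_trans r_ge1.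
have SI : S <= I%:R.
  rewrite /S -[leRHS]mulr_natl mulr1 -[in leRHS](card_ord I) -sum1_card natr_sum.
  apply: ler_sum => l _; rewrite exprn_ile1 ?invr_ge0 ?(ltW r_gt0) //.
  by rewrite invf_le1.
rewrite /Order.min; case: ifP => _; last first.
  rewrite -EFinM -EFinD lee_fin (le_trans kS) // lerD2l ler_wpM2l //.
  exact: le_trans ID2.
case: eqP => [_|/eqP p1].
  rewrite gt0_muley ?addey ?leey // lte_fin mulr_gt0 // exprn_gt0 //.
  by rewrite divr_gt0 ?mulr_gt0 ?powR_gt0.
rewrite -EFinM -EFinD lee_fin (le_trans kS) // lerD2l ler_wpM2l //.
have r_gt1 : 1 < 4 `^ (1 - 1 / p).
  rewrite -[ltLHS](powRr0 4) /powR !(gt_eqF (_ : 0 < 4 :> R)) // ltr_expR mul0r.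
  rewrite mulr_gt0 ?ln_gt0 ?ltr1n // subr_gt0 ltr_pdivrMr ?mul1r.
    by rewrite lt_neqAle eq_sym p1.
  exact: lt_le_trans p_ge1.
have r1 : 0 < 4 `^ (1 - 1 / p) - 1 by rewrite subr_gt0.
(* Partial sum of the geometric series of ratio [q], started at [q]. *)
suff -> : S = (1 - q ^+ I) / (4 `^ (1 - 1 / p) - 1).
  rewrite ler_pM2r ?invr_gt0 // gerBl exprn_ge0 // invr_ge0 ltW //.
rewrite /S; elim: (I) => [|i IH]; first by rewrite big_ord0 expr0 subrr mul0r.
rewrite big_ord_recr /= IH exprS.
have : q * 4 `^ (1 - 1 / p) = 1 by rewrite mulVf // gt_eqF.
move: (q ^+ i) q (4 `^ _) r1 => Q c r r0 cr.
apply: (mulIf (lt0r_neq0 r0)); rewrite mulrDl !divfK ?lt0r_neq0 //.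
rewrite mulrBr mulr1 mulrAC cr; ring.
Qed.

End Growth.

End Deterministic.

(** * Borel measurability for vector-valued functions *)

Lemma measurable_pred d (W : measurableType d) (b : W -> bool) :
  measurable_fun [set: W] b -> measurable [set v | b v].
Proof.
move=> mb; rewrite -[X in measurable X]setTI.
by have := mb measurableT [set true] I.
Qed.

Section BorelVectors.
Variables (R : realType) (n : nat).

Lemma measurable_coord (i : 'I_n) :
  measurable_fun [set: borel_rV R n] (fun x : borel_rV R n => (x : 'rV[R]_n) 0 i).
Proof.
apply: (measurability _ (RGenOInfty.measurableE R)) => //.
move=> _ [_ [a ->] <-]; rewrite setTI; apply: sub_sigma_algebra.
rewrite /= preimage_itvoy.
have /continuousP := @coord_continuous R 1 n 0 i.
by move=> /(_ [set y | a < y]); apply; exact: open_gt.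
Qed.

(** Second countability in the form needed to test measurability coordinate by
    coordinate: the boxes have rational centers and radii. *)
Lemma open_bigcup_rat_box (U : set 'rV[R]_n) : open U ->
  U = \bigcup_(cr in [set cr : 'rV[rat]_n * rat |
         [set u : 'rV[R]_n | forall i, `|ratr (cr.1 0 i) - u 0 i| < ratr cr.2] `<=` U])
      [set u : 'rV[R]_n | forall i, `|ratr (cr.1 0 i) - u 0 i| < ratr cr.2].
Proof.
move=> oU; apply/seteqP; split=> [u Uu|u [cr /= crU] ucr]; last exact: crU.
have [e /= e0 eU] : exists2 e : R, 0 < e & ball u e `<=` U.
  by apply/nbhs_ballP; exact: open_nbhs_nbhs (conj oU Uu).
(* Half of the radius of the ball goes to the center, half to the box. *)
have [r] := @rat_in_itvoo R 0 (e / 2) ltac:(by rewrite divr_gt0).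
rewrite in_itv /= => /andP[r0 re].
have cP (i : 'I_n) : exists c : rat, `|ratr c - u 0 i| < ratr r.
  have [c] := @rat_in_itvoo R (u 0 i - ratr r) (u 0 i + ratr r) ltac:(lra).
  by rewrite in_itv /= -ltr_distl; exists c.
pose c := \row_i projT1 (cid (cP i)).
have uc i : `|ratr (c 0 i) - u 0 i| < ratr r by rewrite mxE; case: cid.
exists (c, r) => //= y yc; apply: eU; split=> // i j; rewrite ord1.
change (`|u 0 j - y 0 j| < e).
have := uc j; have := yc j; rewrite !ltr_distl => /andP[? ?] /andP[? ?].
apply/andP; split; lra.
Qed.

Lemma measurable_rV d (W : measurableType d) (h : W -> borel_rV R n) :
  (forall i, measurable_fun [set: W] (fun v => (h v : 'rV[R]_n) 0 i)) ->
  measurable_fun [set: W] h.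
Proof.
move=> mh; apply: measurability; first by reflexivity.
move=> _ [U oU <-]; rewrite setTI (open_bigcup_rat_box oU) preimage_bigcup.
rewrite bigcup_mkcond; apply: countable_bigcupT_measurable => // cr.
case: ifPn => // _.
have -> : h @^-1` [set u | forall i, `|ratr (cr.1 0 i) - u 0 i| < ratr cr.2] =
    \bigcap_(i in [set: 'I_n])
      [set v | `|ratr (cr.1 0 i) - (h v : 'rV[R]_n) 0 i| < ratr cr.2].
  by apply/seteqP; split=> [v hv i _|v hv i]; [exact: hv|exact: (hv i)].
apply: fin_bigcap_measurable => [|i _]; first exact: finite_finset.
apply: measurable_pred; apply: measurable_fun_ltr => //.
apply: measurableT_comp; first exact: normr_measurable.
by apply: measurable_funB => //; exact: mh.
Qed.

Lemma measurable_dotv d (W : measurableType d) (h1 h2 : W -> borel_rV R n) :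
  measurable_fun [set: W] h1 -> measurable_fun [set: W] h2 ->
  measurable_fun [set: W] (fun v => dotv (h1 v) (h2 v)).
Proof.
move=> m1 m2; apply: measurable_sum => i; apply: measurable_funM.
  exact: (measurableT_comp (measurable_coord i) m1).
exact: (measurableT_comp (measurable_coord i) m2).
Qed.

Lemma measurable_scalev d (W : measurableType d) (a : W -> R)
    (h : W -> borel_rV R n) :
  measurable_fun [set: W] a -> measurable_fun [set: W] h ->
  measurable_fun [set: W] (fun v => a v *: (h v : 'rV[R]_n) : borel_rV R n).
Proof.
move=> ma mh; apply: measurable_rV => i.
under eq_fun do rewrite mxE.
by apply: measurable_funM => //; exact: (measurableT_comp (measurable_coord i) mh).
Qed.

Lemma measurable_subv d (W : measurableType d) (h1 h2 : W -> borel_rV R n) :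
  measurable_fun [set: W] h1 -> measurable_fun [set: W] h2 ->
  measurable_fun [set: W]
    (fun v => (h1 v : 'rV[R]_n) - (h2 v : 'rV[R]_n) : borel_rV R n).
Proof.
move=> m1 m2; apply: measurable_rV => i.
under eq_fun do rewrite !mxE.
apply: measurable_funB; [exact: (measurableT_comp (measurable_coord i) m1)|].
exact: (measurableT_comp (measurable_coord i) m2).
Qed.

(** The inverse is the power [-1] on the nonnegative reals, also at 0, where both
    are 0 by convention. *)
Lemma measurable_invr_enorm_sqr d (W : measurableType d) (h : W -> borel_rV R n) :
  measurable_fun [set: W] h ->
  measurable_fun [set: W] (fun v => (enorm (h v) ^+ 2)^-1).
Proof.
move=> mh; have -> : (fun v => (enorm (h v) ^+ 2)^-1) =
    @powR R ^~ (-1) \o (fun v => dotv (h v) (h v)).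
  by apply/funext => v; rewrite enorm_sqr /= powR_inv1 // dotvv_ge0.
by apply: (measurableT_comp (measurable_powR (-1)) (measurable_dotv mh mh)).
Qed.

(** On each subinterval the increment of [h] lies between the values of the
    subgradients at the two endpoints, so [h x - h 0] lies between the left and
    the right Riemann sums; these differ only by the end terms, divided by the
    number of subintervals. *)
Lemma subgradient_riemann_sum (h : 'rV[R]_n -> R) (v : 'rV[R]_n -> 'rV[R]_n) x :
  (forall y, subdifferential h y (v y)) ->
  (fun m => h 0 + \sum_(i < m.+1) dotv (v ((i%:R / m.+1%:R) *: x)) x / m.+1%:R)
    @ \oo --> h x.
Proof.
move=> hv; set u := (fun m => _).
pose C := dotv (v x) x - dotv (v 0) x.
have bound m : u m <= h x <= u m + C * m.+1%:R^-1.
  have m0 : m.+1%:R != 0 :> R by rewrite pnatr_eq0.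
  pose y (i : nat) : 'rV[R]_n := (i%:R / m.+1%:R) *: x.
  have yS i : y i.+1 - y i = m.+1%:R^-1 *: x.
    by rewrite /y -scalerBl -mulrBl -natr1 addrAC subrr add0r mul1r.
  have lo i : h (y i) + dotv (v (y i)) x / m.+1%:R <= h (y i.+1).
    by have := hv (y i) (y i.+1); rewrite yS dotvZr mulrC.
  have up i : h (y i.+1) - dotv (v (y i.+1)) x / m.+1%:R <= h (y i).
    have := hv (y i.+1) (y i).
    by rewrite -opprB dotvNr yS dotvZr mulrC.
  have y0 : y 0%N = 0 by rewrite /y mul0r scale0r.
  have ym : y m.+1 = x by rewrite /y divff // scale1r.
  have loS k : h 0 + \sum_(i < k) dotv (v (y i)) x / m.+1%:R <= h (y k).
    elim: k => [|k IH]; first by rewrite big_ord0 addr0 y0.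
    rewrite big_ord_recr /= addrA; by rewrite (le_trans _ (lo k)) // lerD2r.
  have upS k : h (y k) <= h 0 + \sum_(i < k) dotv (v (y i)) x / m.+1%:R +
      (dotv (v (y k)) x - dotv (v 0) x) / m.+1%:R.
    elim: k => [|k IH]; first by rewrite big_ord0 y0 subrr mul0r !addr0.
    have := up k; rewrite lerBlDr => /le_trans; apply.
    rewrite (le_trans (lerD IH (lexx _))) // big_ord_recr /= le_eqVlt.
    by apply/orP; left; apply/eqP; ring.
  by apply/andP; split; [have := loS m.+1|have := upS m.+1]; rewrite ym.
apply: (@squeeze_cvgr _ _ _ _ (fun m => h x - C * m.+1%:R^-1) (fun=> h x)).
- apply: nearW => m; have /andP[lo up] := bound m.
  by rewrite lo andbT lerBlDr.
- rewrite -[X in _ --> X](subr0 (h x)) -[in X in _ - X](mulr0 C).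
  apply: cvgB; first exact: cvg_cst.
  by apply: cvgMr; exact: cvg_harmonic.
- exact: cvg_cst.
Qed.

End BorelVectors.

(** * Selection of the worst sample and choice of the sample size *)

Section WorstSample.
Variables (R : realType) (n : nat) (T : Type) (f : T -> 'rV[R]_n -> R).
Variable tie : seq nat -> nat.
Hypothesis tie_fixed : tie_rule tie.

Lemma has_max_seq (h : nat -> R) (r : seq nat) : r != [::] ->
  exists2 l, l \in r & forall j, j \in r -> h j <= h l.
Proof.
elim: r => // a [|b r] IH _; first by exists a => [|j]; rewrite inE // => /eqP ->.
have [//|l lr lmax] := IH; have [hla|hal] := leP (h l) (h a).
  exists a => [|j]; first exact: mem_head.
  by rewrite in_cons => /predU1P[->//|/lmax/le_trans]; apply.
exists l => [|j]; first by rewrite in_cons lr orbT.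
by rewrite in_cons => /predU1P[->|/lmax//]; exact: ltW.
Qed.

Lemma tie_maximizers L (om : nat -> T) x : (0 < L)%N ->
  let l := tie (maximizers f L om x) in
  l \in iota 1 L /\ forall j, j \in iota 1 L -> f (om j) x <= f (om l) x.
Proof.
move=> L0 l; have : l \in maximizers f L om x.
  have [|m mr mmax] := @has_max_seq (fun j => f (om j) x) (iota 1 L).
    by case: L L0 @l.
  apply: tie_fixed; apply/eqP => E.
  have : m \in maximizers f L om x by rewrite mem_filter mr andbT; apply/allP.
  by rewrite E.
by rewrite mem_filter => /andP[/allP].
Qed.

Lemma sample_size_gt0 (Gamma alpha : R) k :
  0 < Gamma < 1 -> 0 < alpha < 1 -> (0 < k)%N ->
  (0 < sample_size Gamma alpha k)%N /\
  Gamma^-1 * ln (2 * k%:R ^+ 2 / alpha) <= (sample_size Gamma alpha k)%:R.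
Proof.
move=> /andP[G0 G1] /andP[a0 a1] k0; rewrite /sample_size.
set y := _ * ln _; have y0 : 0 < y.
  rewrite mulr_gt0 ?invr_gt0 // ln_gt0 // ltr_pdivlMr // mul1r.
  rewrite (lt_le_trans a1) //; have : 1 <= k%:R :> R by rewrite ler1n.
  by rewrite expr2 => ?; nra.
have c0 : 0 < Num.ceil y by rewrite -(ltr_int R) (lt_le_trans y0) // ceil_ge.
split; first by rewrite absz_gt0 gt_eqF.
by rewrite natr_absz gtr0_norm // ceil_ge.
Qed.

End WorstSample.

(** * Measurability of the iterates *)

Section AlgorithmMeasurability.
Variables (R : realType) (n : nat) (d : measure_display) (T : measurableType d).
Variables (f : T -> 'rV[R]_n -> R) (g : T -> 'rV[R]_n -> 'rV[R]_n).
Variables (x0 : 'rV[R]_n) (tie : seq nat -> nat) (Gamma alpha : R).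
Hypothesis f_measurable : forall x, measurable_fun [set: T] (fun w => f w x).
Hypothesis g_subgradient : forall w x, subdifferential (f w) x (g w x).
Hypothesis g_measurable : measurable_fun [set: T * borel_rV R n]
  (fun p => g p.1 p.2 : borel_rV R n).
Hypothesis tie_fixed : tie_rule tie.
Hypotheses (Gamma01 : 0 < Gamma < 1) (alpha01 : 0 < alpha < 1).

(** Only the section at [0] and the subgradient selection enter the Riemann sums,
    and both are measurable. *)
Lemma measurable_f_joint :
  measurable_fun [set: T * borel_rV R n] (fun p => f p.1 p.2).
Proof.
pose h m (p : T * borel_rV R n) := f p.1 0 +
  \sum_(i < m.+1) dotv (g p.1 ((i%:R / m.+1%:R) *: (p.2 : 'rV[R]_n))) p.2 / m.+1%:R.
apply: (@measurable_fun_cvg _ _ _ _ h) => [m|p _]; last first.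
  by apply: subgradient_riemann_sum => y; exact: g_subgradient.
apply: measurable_funD.
  exact: (measurableT_comp (f_measurable 0) measurable_fst).
apply: measurable_sum => i; apply: measurable_funM => //.
apply: measurable_dotv => //.
apply: (measurableT_comp g_measurable (g := fun p : T * borel_rV R n =>
  (p.1, (i%:R / m.+1%:R) *: (p.2 : 'rV[R]_n) : borel_rV R n))).
apply: measurable_fun_pair => //.
exact: measurable_scalev.
Qed.

Section Selection.
Variables (d' : measure_display) (W : measurableType d').

(** The tie-breaking rule is an arbitrary function of the list of maximizers; it
    preserves measurability because this list takes finitely many values. *)
Lemma measurable_filter (r : seq nat) (b : nat -> W -> bool) (C : seq nat -> bool) :
  (forall i, i \in r -> measurable_fun [set: W] (b i)) ->
  measurable_fun [set: W] (fun v => C [seq i <- r | b i v]).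
Proof.
elim: r C => [|a r IH] C mb /=; first exact: measurable_cst.
under eq_fun do rewrite (fun_if C).
apply: measurable_fun_ifT; first by apply: mb; exact: mem_head.
  by apply: (IH (fun s => C (a :: s))) => i ir; apply: mb; rewrite in_cons ir orbT.
by apply: IH => i ir; apply: mb; rewrite in_cons ir orbT.
Qed.

Lemma measurable_all (r : seq nat) (b : nat -> W -> bool) :
  (forall i, i \in r -> measurable_fun [set: W] (b i)) ->
  measurable_fun [set: W] (fun v => all (b ^~ v) r).
Proof.
elim: r => [|a r IH] mb /=; first exact: measurable_cst.
apply: measurable_and.
  by apply: mb; exact: mem_head.
by apply: IH => i ir; apply: mb; rewrite in_cons ir orbT.
Qed.

Lemma measurable_worst_sample (s : nat -> nat -> W -> T) (X : W -> borel_rV R n) k :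
  (0 < k)%N ->
  (forall l, (1 <= l <= sample_size Gamma alpha k)%N ->
     measurable_fun [set: W] (s k l)) ->
  measurable_fun [set: W] X ->
  measurable_fun [set: W]
    (fun v => worst_sample f tie Gamma alpha (fun j l => s j l v) k (X v)).
Proof.
move=> k0 ms mX; have [L0 _] := sample_size_gt0 Gamma01 alpha01 k0.
rewrite /worst_sample; set L := sample_size Gamma alpha k in ms L0 *.
have mem l : l \in iota 1 L -> (1 <= l <= L)%N by rewrite mem_iota add1n ltnS.
have mf l : l \in iota 1 L -> measurable_fun [set: W] (fun v => f (s k l v) (X v)).
  move=> lL; apply: (measurableT_comp measurable_f_joint
    (g := fun v => (s k l v, X v))).
  by apply: measurable_fun_pair => //; apply: ms; exact: mem.
move=> _ B mB; rewrite setTI.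
have -> : (fun v => s k (tie (maximizers f L (fun l => s k l v) (X v))) v) @^-1` B =
   \bigcup_(l in [set` iota 1 L]) ((s k l @^-1` B) `&`
      [set v | tie (maximizers f L (fun l => s k l v) (X v)) == l]).
  apply/seteqP; split=> [v /= Bv|v [l /= lL [/= Bv /eqP lE]]]; last by rewrite lE.
  have [lL _] := tie_maximizers f tie_fixed (fun l => s k l v) (X v) L0.
  by exists (tie (maximizers f L (fun l => s k l v) (X v))) => //; split => /=.
apply: fin_bigcup_measurable => [|l /= lL]; first exact: finite_seq.
apply: measurableI.
  by rewrite -[X in measurable X]setTI; apply: ms => //; exact: mem.
apply: measurable_pred; apply: (@measurable_filter _ _ (fun r => tie r == l)).
move=> i iL; apply: measurable_all => j jL.
by apply: measurable_fun_ler; exact: mf.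
Qed.

Variable s : nat -> nat -> W -> T.

(** Only the samples that the algorithm draws are assumed measurable: the space [W]
    will carry the sigma-algebra of these samples alone. *)
Lemma measurable_pfm_x k :
  (forall j l, (1 <= j <= k)%N -> (1 <= l <= sample_size Gamma alpha j)%N ->
     measurable_fun [set: W] (s j l)) ->
  measurable_fun [set: W]
    (fun v => pfm_x f g tie x0 Gamma alpha (fun j l => s j l v) k : borel_rV R n).
Proof.
elim: k => [|k IH] ms; first exact: measurable_cst.
have mx : measurable_fun [set: W] (fun v =>
    pfm_x f g tie x0 Gamma alpha (fun j l => s j l v) k : borel_rV R n).
  by apply: IH => j l /andP[j1 jk]; apply: ms; rewrite j1 leqW.
have mw := measurable_worst_sample (ltn0Sn k) (fun l => ms k.+1 l (leqnn _)) mx.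
have mwx := measurable_fun_pair mw mx.
have mf := measurableT_comp measurable_f_joint mwx.
have mg := measurableT_comp g_measurable mwx.
rewrite /=; apply: measurable_fun_ifT => //; first exact: measurable_fun_ler.
apply: measurable_subv => //; apply: measurable_scalev => //.
apply: measurable_funM => //; exact: measurable_invr_enorm_sqr.
Qed.

End Selection.
End AlgorithmMeasurability.

(** * Integration over a fresh independent sample *)

Lemma measurable_preim d d' (W : measurableType d) (Z : measurableType d')
    (X : W -> Z) (A : set Z) :
  measurable_fun [set: W] X -> measurable A -> measurable (X @^-1` A).
Proof. by move=> mX mA; rewrite -[X in measurable X]setTI; exact: mX. Qed.

(** The image by [X] of the measure [Q] restricted to [G].  The proofs [mG] and
    [mX] are arguments so that the measure structure can be inferred from the
    term. *)
Definition restricted_law (R : realType) (d d' : measure_display)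
    (W : measurableType d) (Z : measurableType d') (Q : probability W R)
    (G : set W) (mG : measurable G) (X : W -> Z)
    (mX : measurable_fun [set: W] X) : set Z -> \bar R :=
  fun A => Q (X @^-1` A `&` G).

Section RestrictedLaw.
Variables (R : realType) (d d' : measure_display).
Variables (W : measurableType d) (Z : measurableType d') (Q : probability W R).
Variables (G : set W) (mG : measurable G) (X : W -> Z).
Variable mX : measurable_fun [set: W] X.
Local Notation law := (restricted_law Q mG mX).

Let law0 : law set0 = 0%E.
Proof. by rewrite /restricted_law preimage_set0 set0I measure0. Qed.

Let law_ge0 A : (0 <= law A)%E.
Proof. exact: measure_ge0. Qed.

Let law_sigma_additive : semi_sigma_additive law.
Proof.
have -> : law = pushforward (mrestr Q mG) X by [].
exact: measure_semi_sigma_additive.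
Qed.

HB.instance Definition _ := isMeasure.Build _ _ _ law
  law0 law_ge0 law_sigma_additive.

Let law_fin : fin_num_fun law.
Proof.
move=> A mA; apply: fin_num_measure; apply: measurableI => //.
exact: measurable_preim.
Qed.

HB.instance Definition _ := Measure_isFinite.Build _ _ _ law law_fin.

End RestrictedLaw.

Section IndependentSections.
Variables (R : realType) (d d1 d2 : measure_display).
Variables (W : measurableType d) (Z : measurableType d1) (T : measurableType d2).
Variables (Q : probability W R) (P : probability T R).
Variables (G : set W) (mG : measurable G) (X : W -> Z) (Y : W -> T).
Hypotheses (mX : measurable_fun [set: W] X) (mY : measurable_fun [set: W] Y).
Hypothesis indep : forall A B, measurable A -> measurable B ->
  Q (X @^-1` A `&` G `&` Y @^-1` B) = (Q (X @^-1` A `&` G) * P B)%E.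

(** Under [Q] restricted to [G], the joint law of [X] and [Y] agrees with the
    product measure on rectangles, hence everywhere; Fubini then integrates the
    bound on the sections. *)
Lemma prob_section_le (E : set (Z * T)) (c : R) : 0 <= c -> measurable E ->
  (forall z, (P (xsection E z) <= c%:E)%E) ->
  (Q (G `&` [set v | E (X v, Y v)]) <= c%:E * Q G)%E.
Proof.
move=> c0 mE Ec.
have mXY := measurable_fun_pair mX mY.
have <- : restricted_law Q mG mXY E = Q (G `&` [set v | E (X v, Y v)]).
  by rewrite /restricted_law setIC.
rewrite -(@product_measure_unique _ _ _ _ _ (restricted_law Q mG mX) P
    (restricted_law Q mG mXY)) //; last first.
  move=> A B mA mB /=; rewrite /restricted_law -indep //.
  by congr (Q _); apply/seteqP; split=> v /= [[? ?] ?].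
rewrite /product_measure1.
apply: (@le_trans _ _ (\int[restricted_law Q mG mX]_(z in setT) cst c%:E z)%E).
  apply: ge0_le_integral => //; first exact: measurable_fun_xsection.
  by move=> z _; exact: Ec.
by rewrite integral_cst //= /restricted_law preimage_setT setTI.
Qed.

End IndependentSections.

Section Past.
Variables (R : realType) (d d' : measure_display).
Variables (W : measurableType d) (T : measurableType d').
Variables (Q : probability W R) (P : probability T R).
Variables (I : choiceType) (J : set I) (S : I -> W -> T).
Hypothesis iidS : iid_with_law Q P J S.

(** A pi-system that generates the sigma-algebra of the samples with index in
    [r]. *)
Definition past_rectangles (r : seq I) : set (set W) :=
  [set E | exists2 A : I -> set T, (forall i, measurable (A i)) &
     E = \bigcap_(i in [set` r]) (S i @^-1` A i)].

Lemma past_rectangles_setI r : setI_closed (past_rectangles r).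
Proof.
move=> _ _ [A mA ->] [B mB ->]; exists (fun i => A i `&` B i).
  by move=> i; exact: measurableI.
by rewrite -bigcapI.
Qed.

Lemma past_rectangles_setT r : past_rectangles r setT.
Proof.
exists (fun=> setT) => //; apply/seteqP; split=> // v _ i _ //.
Qed.

Lemma past_rectangles_sample r i A : i \in r -> measurable A ->
  past_rectangles r (S i @^-1` A).
Proof.
move=> ir mA; exists (fun j => if j == i then A else setT) => [j|].
  by case: ifP.
apply/seteqP; split=> [v Av j _|v /(_ i ir)] /=; last by rewrite eqxx.
by case: eqP => [->|].
Qed.

Lemma measurable_past_rectangles r :
  [set` r] `<=` J -> past_rectangles r `<=` measurable.
Proof.
have [mS _ _] := iidS.
move=> rJ _ [A mA ->]; apply: fin_bigcap_measurable; first exact: finite_seq.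
by move=> i /rJ Ji; apply: measurable_preim => //; exact: mS.
Qed.

Lemma measurable_past r E :
  [set` r] `<=` J -> <<s past_rectangles r >> E -> measurable E.
Proof.
move=> rJ; apply: smallest_sub; first exact: sigma_algebra_measurable.
exact: measurable_past_rectangles.
Qed.

(** Independence is given on rectangles; both sides are finite measures in [E], so
    they agree on the generated sigma-algebra. *)
Lemma past_independent r j E B : [set` r] `<=` J -> J j -> j \notin r ->
  <<s past_rectangles r >> E -> measurable B ->
  Q (E `&` S j @^-1` B) = (Q E * P B)%E.
Proof.
move=> rJ Jj jr pE mB; have [mS lawS indS] := iidS.
have mSB : measurable (S j @^-1` B) by apply: measurable_preim => //; exact: mS.
pose b : {nonneg R} := NngNum (fine_ge0 (measure_ge0 P B)).
have bE : (b%:num)%:E = P B by rewrite /= fineK // fin_num_measure.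
rewrite muleC -bE.
have cover : \bigcup_(k : nat) (fun=> setT) k = [set: W].
  by apply: bigcup_const; exists 0%N.
suff : mrestr Q mSB E = mscale b Q E by [].
apply: (@g_sigma_algebra_measure_unique _ _ _ (past_rectangles r)
  (measurable_past_rectangles rJ) (fun=> setT) (fun=> past_rectangles_setT r)
  cover) => //.
- exact: past_rectangles_setI.
- move=> _ [A mA ->]; rewrite /= /mrestr /mscale bE.
  (* A rectangle over [r] cut by a condition on sample [j] is a rectangle over
     [j :: r]; repetitions in [r] are removed since independence is stated for
     lists of distinct indices. *)
  pose A' i := if i == j then B else A i.
  have mA' i : measurable (A' i) by rewrite /A'; case: ifP.
  have ju : j \notin undup r by rewrite mem_undup.
  have rE : [set` undup r] = [set` r].
    by apply/seteqP; split=> i /=; rewrite mem_undup.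
  have jrJ : [set` j :: undup r] `<=` J.
    move=> i /=; rewrite inE => /predU1P[->//|]; rewrite mem_undup; exact: rJ.
  have A'E i : i \in undup r -> A' i = A i.
    by rewrite /A'; case: eqP => // ->; rewrite (negPf ju).
  have := indS (j :: undup r) A';
  rewrite cons_uniq ju undup_uniq => /(_ isT jrJ mA').
  rewrite big_cons {2}/A' eqxx lawS //.
  rewrite -(indS (undup r) A') ?undup_uniq //; last by rewrite rE.
  have <- : \bigcap_(i in [set` undup r]) (S i @^-1` A' i) =
      \bigcap_(i in [set` r]) (S i @^-1` A i).
    by rewrite rE; apply: eq_bigcapr => i /=; rewrite -mem_undup => /A'E ->.
  move=> <-; congr (Q _); rewrite setIC.
  apply/seteqP; split=> [v [Bv Av] i|v Av].
    by rewrite /= inE => /predU1P[->|]; [rewrite /A' eqxx|exact: Av].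
  split; first by have := Av j; rewrite /A' eqxx; apply; exact: mem_head.
  by move=> i ir; apply: Av; rewrite /= in_cons ir orbT.
- by move=> k; rewrite /= /mrestr setTI (le_lt_trans (probability_le1 _ _)) // ltry.
Qed.

(** Here [X] and [G] are determined by the samples in [r], and the new sample falls
    into the section of [E] at [X] with probability at most [c]. *)
Lemma fresh_sample_le (d1 : measure_display) (Z : measurableType d1) r j
    (X : W -> Z) (G : set W) (E : set (Z * T)) (c : R) :
  [set` r] `<=` J -> J j -> j \notin r ->
  measurable_fun [set: g_sigma_algebraType (past_rectangles r)] X ->
  <<s past_rectangles r >> G -> 0 <= c -> measurable E ->
  (forall z, (P (xsection E z) <= c%:E)%E) ->
  (Q (G `&` [set v | E (X v, S j v)]) <= c%:E * Q G)%E.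
Proof.
move=> rJ Jj jr pX pG c0 mE Ec; have [mS _ _] := iidS.
have pXA A : measurable A -> <<s past_rectangles r >> (X @^-1` A).
  by move=> mA; have := pX measurableT A mA; rewrite setTI.
have mX : measurable_fun [set: W] X.
  by move=> _ A mA; rewrite setTI; apply: (measurable_past rJ); exact: pXA.
have mG := measurable_past rJ pG.
apply: (@prob_section_le _ _ _ _ _ _ _ Q P G mG X (S j)) => //; first exact: mS.
move=> A B mA mB; apply: (past_independent rJ) => //.
apply: (@measurableI _ (g_sigma_algebraType (past_rectangles r))) => //.
exact: pXA.
Qed.

End Past.

(** * The probability of an error in one iteration *)

(** The set is a lower set for the values of [Y].  If [Y] attains a maximum on it,
    it is a sublevel set of probability less than [c]; otherwise it is empty
    or an increasing union of such sublevel sets, and the bound passes to the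
    limit. *)
Lemma prob_low_values (R : realType) d (T : measurableType d)
    (P : probability T R) (Y : T -> R) (c : R) :
  measurable_fun [set: T] Y -> 0 <= c ->
  (P [set w | (P [set w' | (Y w' <= Y w)%R] < c%:E)%E] <= c%:E)%E.
Proof.
move=> mY c0; pose F t := P [set w | Y w <= t].
have mle t : measurable [set w | Y w <= t].
  by apply: measurable_pred; apply: measurable_fun_ler.
have Fle t u : t <= u -> (F t <= F u)%E.
  by move=> tu; apply: le_measure; rewrite ?inE // => w /= /le_trans; apply.
pose A := [set w | (F (Y w) < c%:E)%E]; rewrite -/A.
have [[w0 Aw0 Amax]|nomax] :=
    pselect (exists2 w0, A w0 & forall w, A w -> Y w <= Y w0).
  suff -> : A = [set w | Y w <= Y w0] by exact: ltW.
  apply/seteqP; split=> w; first exact: Amax.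
  by move=> /= ww0; exact: le_lt_trans (Fle _ _ ww0) Aw0.
have above w : A w -> exists2 w', A w' & Y w < Y w'.
  move=> Aw; apply: contrapT => nex; apply: nomax; exists w => // w' Aw'.
  by rewrite leNgt; apply/negP => ?; apply: nex; exists w'.
(* An enumeration of the rationals; the default value merely repeats 0. *)
pose q i : R := ratr (odflt 0 (unpickle i)).
pose G i := if (F (q i) < c%:E)%E then [set w | Y w <= q i] else set0.
have mG i : measurable (G i) by rewrite /G; case: ifP.
have -> : A = \bigcup_i G i.
  apply/seteqP; split=> [w /above[w' Aw' /rat_in_itvoo[r]]|w [i _]].
    rewrite in_itv /= => /andP[wr rw']; exists (pickle r) => //.
    rewrite /G /q pickleK /= (le_lt_trans (Fle _ _ (ltW rw')) Aw') /=.
    exact: ltW.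
  rewrite /G; case: ifP => // Fq /= wq.
  exact: le_lt_trans (Fle _ _ wq) Fq.
pose B n := \big[setU/set0]_(i < n.+1) G i.
have BP n : B n = set0 \/ exists2 t, (F t < c%:E)%E & B n = [set w | Y w <= t].
  rewrite /B; elim: n.+1 => [|m IH]; first by left; rewrite big_ord0.
  rewrite big_ord_recr /= {2 4}/G; case: ifP => [Fq|_]; last first.
    by rewrite setU0.
  right; case: IH => [->|[t Ft ->]]; first by exists (q m) => //; rewrite set0U.
  have [tq|qt] := leP t (q m).
    by exists (q m) => //; apply/setUidr => w /= /le_trans; apply.
  by exists t => //; apply/setUidl => w /= /le_trans; apply; exact: ltW.
have mB n : measurable (B n) by exact: bigsetU_measurable.
have ndB : nondecreasing_seq B.
  by move=> m k mk; apply/subsetPset; exact: subset_bigsetU.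
have cv := @nondecreasing_cvg_mu _ _ _ P _ mB (bigcupT_measurable _ mB) ndB.
rewrite -bigcup_bigsetU_bigcup -(cvg_lim _ cv) //.
apply: lime_le; first by apply/cvg_ex; eexists; exact: cv.
apply: nearW => m /=; case: (BP m) => [->|[t Ft ->]]; first by rewrite measure0.
exact: ltW.
Qed.

(** Comparison with the telescoping sum of [1 / (i (i + 1))]. *)
Lemma sum_inv_sqr_le (R : realType) m :
  \sum_(i < m.+1) (i.+1%:R ^- 2 : R) <= 2 - m.+1%:R^-1.
Proof.
elim: m => [|m IH]; first by rewrite big_ord1 /= expr1n invr1; lra.
rewrite big_ord_recr /=; apply: le_trans (lerD IH (lexx _)) _.
have a0 : 0 < m.+1%:R :> R by rewrite ltr0n.
have -> : m.+2%:R = m.+1%:R + 1 :> R by rewrite -natr1.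
move: (m.+1%:R : R) a0 => a a0.
have a1 : 0 < a + 1 by rewrite addr_gt0.
have : (a + 1) ^- 2 <= a^-1 - (a + 1)^-1.
  have -> : a^-1 - (a + 1)^-1 = (a * (a + 1))^-1.
    by field; rewrite !gt_eqF.
  rewrite lef_pV2 ?posrE ?exprn_gt0 ?mulr_gt0 // expr2 ler_pM2r //; lra.
lra.
Qed.

(** The sample size is chosen so that [exp (- Gamma L) <= alpha / (2 k^2)]. *)
Lemma sample_size_tail (R : realType) (Gamma alpha : R) k :
  0 < Gamma < 1 -> 0 < alpha < 1 -> (0 < k)%N ->
  (1 - Gamma) ^+ sample_size Gamma alpha k <= alpha / 2 * k%:R ^- 2.
Proof.
move=> G01 a01 k0; have [_] := sample_size_gt0 G01 a01 k0.
move: G01 a01 => /andP[G0 G1] /andP[a0 _].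
have kR : 0 < k%:R :> R by rewrite ltr0n.
set L := sample_size _ _ _; rewrite mulrC ler_pdivrMr // => lnL.
apply: (@le_trans _ _ (expR (- Gamma) ^+ L)).
  by apply: lerXn2r; rewrite ?nnegrE ?subr_ge0 ?expR_ge0 ?(ltW G1) // expR_ge1Dx.
rewrite -expRM_natl mulrN.
have -> : alpha / 2 * k%:R ^- 2 = expR (- ln (2 * k%:R ^+ 2 / alpha)).
  rewrite expRN lnK ?posrE ?divr_gt0 ?mulr_gt0 ?exprn_gt0 //.
  by field; rewrite !gt_eqF.
by rewrite ler_expR lerN2.
Qed.

Section ErrorProbability.
Variables (R : realType) (n : nat) (d : measure_display) (T : measurableType d).
Variables (P : probability T R).
Variables (f : T -> 'rV[R]_n -> R) (g : T -> 'rV[R]_n -> 'rV[R]_n).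
Variables (x0 : 'rV[R]_n) (tie : seq nat -> nat) (Gamma alpha : R).
Hypothesis f_measurable : forall x, measurable_fun [set: T] (fun w => f w x).
Hypothesis g_subgradient : forall w x, subdifferential (f w) x (g w x).
Hypothesis g_measurable : measurable_fun [set: T * borel_rV R n]
  (fun p => g p.1 p.2 : borel_rV R n).
Hypothesis tie_fixed : tie_rule tie.
Hypotheses (Gamma01 : 0 < Gamma < 1) (alpha01 : 0 < alpha < 1).
Variables (d' : measure_display) (W : measurableType d') (Q : probability W R).
Variable S : nat * nat -> W -> T.
Hypothesis iidS : iid_with_law Q P (sample_indices Gamma alpha) S.

Local Notation L := (sample_size Gamma alpha).

(** The pairs of a point and of a sample whose value at this point, if it were the
    largest value found, would make an error. *)
Definition bad_pairs : set (borel_rV R n * T) :=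
  [set z | (P (Omega_le f z.1 (f z.2 z.1)) < (1 - Gamma)%:E)%E].

Lemma measurable_Omega_le x e : measurable (Omega_le f x e).
Proof. by apply: measurable_pred; apply: measurable_fun_ler. Qed.

(** The probability in the definition is the measure of a section of a measurable
    set of triples (point, sample, integration variable). *)
Lemma measurable_bad_pairs : measurable bad_pairs.
Proof.
pose E := [set z : (borel_rV R n * T) * T | f z.2 z.1.1 <= f z.1.2 z.1.1].
have mf := measurable_f_joint f_measurable g_subgradient g_measurable.
have mE : measurable E.
  apply: measurable_pred; apply: measurable_fun_ler.
    apply: (measurableT_comp mf
      (g := fun z : (borel_rV R n * T) * T => (z.2, z.1.1))).
    apply: measurable_fun_pair => //.
    exact: (measurableT_comp measurable_fst measurable_fst).
  apply: (measurableT_comp mf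
    (g := fun z : (borel_rV R n * T) * T => (z.1.2, z.1.1))).
  apply: measurable_fun_pair.
    exact: (measurableT_comp measurable_snd measurable_fst).
  exact: (measurableT_comp measurable_fst measurable_fst).
have := emeasurable_fun_infty_o measurableT (measurable_fun_xsection P mE)
  (1 - Gamma)%:E.
rewrite setTI; congr measurable; apply/seteqP; split=> -[x w];
  rewrite /bad_pairs /= (_ : xsection E (x, w) = Omega_le f x (f w x)) //;
  by apply/seteqP; split=> w'; rewrite /xsection /= inE.
Qed.

Lemma prob_bad_pairs_section x : (P (xsection bad_pairs x) <= (1 - Gamma)%:E)%E.
Proof.
have -> : xsection bad_pairs x =
    [set w | (P [set w' | (f w' x <= f w x)%R] < (1 - Gamma)%:E)%E].
  by apply/seteqP; split=> w; rewrite /xsection /= inE.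
by apply: prob_low_values => //; rewrite subr_ge0; case/andP: Gamma01 => _ /ltW.
Qed.

Local Notation xk k v := (pfm_x f g tie x0 Gamma alpha (fun j l => S (j, l) v) k).
Local Notation ek k v := (pfm_eps f g tie x0 Gamma alpha (fun j l => S (j, l) v) k).

Definition error_at k : set W :=
  [set v | (P (Omega_le f (xk k v) (ek k v)) < (1 - Gamma)%:E)%E].

(** The samples drawn in iteration [k.+1] are compared with the point [x_k]. *)
Definition first_samples_bad k m : set W :=
  [set v | forall l, (1 <= l <= m)%N -> bad_pairs (xk k v, S (k.+1, l) v)].

(** All the samples drawn before sample [m.+1] of iteration [k.+1]. *)
Definition earlier_indices k m : seq (nat * nat) :=
  [seq (j, l) | j <- iota 1 k, l <- iota 1 (L j)] ++
  [seq (k.+1, l) | l <- iota 1 m].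

Lemma mem_earlier_indices k m j l : (j, l) \in earlier_indices k m =
  ((1 <= j <= k) && (1 <= l <= L j) || (j == k.+1) && (1 <= l <= m))%N.
Proof.
rewrite mem_cat; congr (_ || _).
  apply/allpairsPdep/andP => [[j' [l' []]]|[jk lL]].
    by rewrite !mem_iota !add1n !ltnS => ? ? [-> ->].
  by exists j, l; rewrite !mem_iota !add1n !ltnS.
apply/mapP/andP => [[l' + [-> ->]]|[/eqP -> lm]].
  by rewrite mem_iota add1n ltnS eqxx.
by exists l; rewrite // mem_iota add1n ltnS.
Qed.

Lemma earlier_indices_sub k m : (m <= L k.+1)%N ->
  [set` earlier_indices k m] `<=` sample_indices Gamma alpha.
Proof.
move=> mL [j l] /=; rewrite mem_earlier_indices /sample_indices /=.
case/orP => [/andP[/andP[j1 _] lL]|/andP[/eqP -> /andP[l1 lm]]]; split => //.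
by rewrite l1 (leq_trans lm).
Qed.

Lemma next_sample_notin k m : (k.+1, m.+1) \notin earlier_indices k m.
Proof. by rewrite mem_earlier_indices !ltnn !andbF. Qed.

Lemma measurable_past_sample r j l : (j, l) \in r ->
  measurable_fun [set: g_sigma_algebraType (past_rectangles S r)] (S (j, l)).
Proof.
move=> jr _ A mA; rewrite setTI; apply: sub_sigma_algebra.
exact: past_rectangles_sample.
Qed.

Lemma measurable_past_pfm_x k m :
  measurable_fun [set: g_sigma_algebraType (past_rectangles S (earlier_indices k m))]
    (fun v => xk k v : borel_rV R n).
Proof.
apply: (measurable_pfm_x x0 f_measurable g_subgradient g_measurable tie_fixed
  Gamma01 alpha01
  (W := g_sigma_algebraType (past_rectangles S (earlier_indices k m)))
  (s := fun j l => S (j, l))).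
move=> j l jk lL; apply: measurable_past_sample.
by rewrite mem_earlier_indices jk lL.
Qed.

Lemma past_first_samples_bad k m :
  <<s past_rectangles S (earlier_indices k m) >> (first_samples_bad k m).
Proof.
have -> : first_samples_bad k m = \bigcap_(l in [set` iota 1 m])
    [set v | bad_pairs (xk k v, S (k.+1, l) v)].
  apply/seteqP; split=> v h l /=; first by rewrite mem_iota add1n ltnS; exact: h.
  by move=> lm; apply: h; rewrite /= mem_iota add1n ltnS.
apply: (@fin_bigcap_measurable _ (g_sigma_algebraType
  (past_rectangles S (earlier_indices k m)))); first exact: finite_seq.
move=> l /=; rewrite mem_iota add1n ltnS => lm.
suff mXS : measurable_fun
    [set: g_sigma_algebraType (past_rectangles S (earlier_indices k m))]
    (fun v => (xk k v : borel_rV R n, S (k.+1, l) v)).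
  by have := mXS measurableT _ measurable_bad_pairs; rewrite setTI.
apply: measurable_fun_pair; first exact: measurable_past_pfm_x.
by apply: measurable_past_sample; rewrite mem_earlier_indices eqxx lm orbT.
Qed.

(** The samples of an iteration are added one by one; each is fresh with respect to
    the point [x_k] and to the preceding samples. *)
Lemma prob_first_samples_bad k m : (m <= L k.+1)%N ->
  (Q (first_samples_bad k m) <= ((1 - Gamma) ^+ m)%:E)%E.
Proof.
have G1 : 0 <= 1 - Gamma by rewrite subr_ge0; case/andP: Gamma01 => _ /ltW.
elim: m => [|m IH] mL.
  rewrite expr0 (le_trans (probability_le1 _ _)) //.
  apply: (measurable_past iidS (earlier_indices_sub (leq0n _))).
  exact: past_first_samples_bad.
have -> : first_samples_bad k m.+1 = first_samples_bad k m `&`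
    [set v | bad_pairs (xk k v, S (k.+1, m.+1) v)].
  apply/seteqP; split=> [v h|v [h hm] l /andP[l1]].
    split=> [l /andP[l1 lm]|]; first by apply: h; rewrite l1 leqW.
    by apply: h; rewrite /= leqnn.
  by rewrite leq_eqVlt => /predU1P[->//|lm]; apply: h; rewrite l1.
have Jkm : sample_indices Gamma alpha (k.+1, m.+1) by [].
have step := fresh_sample_le iidS (earlier_indices_sub (ltnW mL)) Jkm
  (next_sample_notin k m) (@measurable_past_pfm_x k m)
  (past_first_samples_bad (k := k) (m := m)) G1 measurable_bad_pairs
  prob_bad_pairs_section.
apply: (le_trans step).
by rewrite exprS EFinM lee_wpmul2l ?lee_fin // IH // ltnW.
Qed.

(** The selected value is the largest, and the probability of a sublevel set
    increases with the level. *)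
Lemma error_at_sub k : error_at k `<=` first_samples_bad k (L k.+1).
Proof.
have [L0 _] := sample_size_gt0 Gamma01 alpha01 (ltn0Sn k).
move=> v err l lL; apply: le_lt_trans err.
have [_ wmax] := tie_maximizers f tie_fixed (fun l => S (k.+1, l) v) (xk k v) L0.
apply: le_measure; rewrite ?inE; [exact: measurable_Omega_le..|].
move=> w /= /le_trans; apply; apply: wmax.
by rewrite mem_iota add1n ltnS.
Qed.

Lemma measurable_error_at k : measurable (error_at k).
Proof.
have [mS _ _] := iidS.
have mSkl j l : (1 <= j)%N -> (1 <= l <= L j)%N ->
    measurable_fun [set: W] (S (j, l)).
  by move=> j1 lL; apply: mS.
have mx : measurable_fun [set: W] (fun v => xk k v : borel_rV R n).
  apply: (@measurable_pfm_x _ _ _ _ _ _ x0 _ _ _ f_measurable g_subgradient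
    g_measurable tie_fixed Gamma01 alpha01 _ _ (fun j l => S (j, l))).
  by move=> j l /andP[j1 _]; exact: mSkl.
have mw := measurable_worst_sample f_measurable g_subgradient g_measurable
  tie_fixed Gamma01 alpha01 (s := fun j l => S (j, l)) (ltn0Sn k)
  (fun l => mSkl k.+1 l (ltn0Sn k)) mx.
exact: (measurable_preim (measurable_fun_pair mx mw) measurable_bad_pairs).
Qed.

Lemma prob_error_at k : (Q (error_at k) <= (alpha / 2 * k.+1%:R ^- 2)%:E)%E.
Proof.
apply: (@le_trans _ _ (Q (first_samples_bad k (L k.+1)))).
  apply: le_measure; rewrite ?inE;
    [exact: measurable_error_at| |exact: error_at_sub].
  apply: (measurable_past iidS (earlier_indices_sub (leqnn _))).
  exact: past_first_samples_bad.
apply: le_trans (prob_first_samples_bad (leqnn _)) _.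
by rewrite lee_fin sample_size_tail.
Qed.

(** Union bound over the iterations. *)
Lemma prob_no_errors :
  let no_errors := [set v : W |
    makes_no_errors P f g tie x0 Gamma alpha (fun k l => S (k, l) v)] in
  measurable no_errors /\ ((1 - alpha)%:E <= Q no_errors)%E.
Proof.
move=> no_errors; have alpha0 : 0 < alpha by case/andP: alpha01.
have mU : measurable (\bigcup_k error_at k).
  by apply: bigcupT_measurable => k; exact: measurable_error_at.
have -> : no_errors = ~` (\bigcup_k error_at k).
  apply/seteqP; split=> [v ok [k _]|v ok k].
    by rewrite /error_at /= ltNge ok.
  by rewrite leNgt; apply/negP => err; apply: ok; exists k.
split; first exact: measurableC.
rewrite probability_setC // EFinB leeB //.
apply: le_trans (generalized_Boole_inequality Q measurable_error_at mU) _.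
apply: lime_le; first by apply: is_cvg_nneseries => k _ _; exact: measure_ge0.
apply: nearW => m; rewrite big_mkord.
apply: (@le_trans _ _ (\sum_(i < m) (alpha / 2 * i.+1%:R ^- 2)%:E)%E).
  by apply: lee_sum => i _; exact: prob_error_at.
rewrite sumEFin lee_fin -mulr_sumr; case: m => [|m].
  by rewrite big_ord0 mulr0 ltW.
rewrite mulrAC ler_pdivrMr // ler_wpM2l ?(ltW alpha0) //.
by rewrite (le_trans (sum_inv_sqr_le _ _)) // gerBl invr_ge0.
Qed.

End ErrorProbability.

(** * Growth inequality and conclusion *)

(** Otherwise the event of the growth assumption and [Omega_le f x e] would be
    disjoint, with probabilities that add up to more than 1. *)
Lemma growth_of_no_errors (R : realType) (n : nat) (d : measure_display)
    (T : measurableType d) (P : probability T R) (f : T -> 'rV[R]_n -> R)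
    (B : set 'rV[R]_n) (mu p Delta Gamma e : R) x :
  (forall x, measurable_fun [set: T] (fun w => f w x)) ->
  growth_assumption P f B mu p Delta -> Gamma < Delta ->
  B x -> ~ feasible f x -> ((1 - Gamma)%:E <= P (Omega_le f x e))%E ->
  mu * dist_to x (feasible f) `^ p <= e.
Proof.
move=> mf [_ _ _ growth] GD Bx nXx ok; rewrite leNgt; apply/negP => elt.
have mO : measurable (Omega_le f x e) by exact: measurable_Omega_le.
set A := [set w | mu * dist_to x (feasible f) `^ p <= f w x].
have mA : measurable A by apply: measurable_pred; apply: measurable_fun_ler.
have PA : (Delta%:E <= P A)%E by exact: growth.
have dis : Omega_le f x e `&` A = set0.
  apply/seteqP; split=> // w [/= we wA].
  by have := lt_le_trans elt (le_trans wA we); rewrite ltxx.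
have := probability_le1 P (measurableU _ _ mO mA).
rewrite measureU // leNgt => /negP; apply.
apply: lt_le_trans (leeD ok PA).
by rewrite -EFinD lte_fin; lra.
Qed.

Theorem theorem4p1 (R : realType) (n : nat) (d : measure_display)
    (T : measurableType d) (P : probability T R)
    (f : T -> 'rV[R]_n -> R) (g : T -> 'rV[R]_n -> 'rV[R]_n)
    (x0 z0 : 'rV[R]_n) (M : R) (tie : seq nat -> nat) (Gamma alpha : R)
    (f_convex : forall w, convex_function [set: convex_lmodType 'rV[R]_n] (f w))
    (f_measurable : forall x, measurable_fun [set: T] (fun w => f w x))
    (g_subgradient : forall w x, subdifferential (f w) x (g w x))
    (z0_closest : is_closest_point (feasible f) x0 z0)
    (f_lipschitz : forall w, exists U : set 'rV[R]_n,
      [/\ open U, eball z0 (enorm (x0 - z0)) `<=` U & elipschitz M U (f w)])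
    (tie_fixed : tie_rule tie)
    (Gamma01 : 0 < Gamma < 1) (alpha01 : 0 < alpha < 1) :
  [/\
   (* (a) *)
   forall (d' : measure_display) (W : measurableType d') (Q : probability W R)
     (S : nat * nat -> W -> T),
     iid_with_law Q P (sample_indices Gamma alpha) S ->
     measurable_fun [set: T * borel_rV R n]
       (fun p => g p.1 p.2 : borel_rV R n) ->
     let no_errors := [set v : W |
       makes_no_errors P f g tie x0 Gamma alpha (fun k l => S (k, l) v)] in
     measurable no_errors /\ ((1 - alpha)%:E <= Q no_errors)%E,
   (* (b) *)
   forall (eps : R),
     0 < eps < M * dist_to x0 (feasible f) ->
     forall s : nat -> nat -> T,
     exists k : nat,
       pfm_eps f g tie x0 Gamma alpha s k <= eps /\
       k.+1%:Z <= 1 + Num.floor ((M * dist_to x0 (feasible f) / eps) ^+ 2)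
   & (* (c) *)
   forall (eps mu p Delta : R),
     0 < eps < M * dist_to x0 (feasible f) ->
     growth_assumption P f (eball z0 (enorm (x0 - z0))) mu p Delta ->
     Gamma < Delta ->
     forall s : nat -> nat -> T,
     makes_no_errors P f g tie x0 Gamma alpha s ->
     exists k : nat,
       pfm_eps f g tie x0 Gamma alpha s k <= eps /\
       (k.+1%:R%:E <=
        5%:E + (4 * (M / (mu `^ (1 / p) * eps `^ (1 - 1 / p))) ^+ 2)%R%:E
             * mine (if p == 1%R then +oo
                     else (1 / (4 `^ (1 - 1 / p) - 1))%R%:E)
                    (log2 (M * dist_to x0 (feasible f) / eps))%R%:E)%E].
Proof.
have Xz0 := proj1 z0_closest.
split=> [d' W Q S iidS mg|eps|eps mu p Delta].
- exact: prob_no_errors.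
- move=> /andP[eps0 epsD] s; have M0 := lipschitz_gt0 z0_closest eps0 epsD.
  have [k ek kle] := reach_within_dist (tie := tie) (Gamma := Gamma)
    (alpha := alpha) (s := s) g_subgradient z0_closest
    f_lipschitz M0 (k := 0) eps0 (lexx _).
  by exists k; split=> //; rewrite -addn1 PoszD addrC lerD2l.
- move=> /andP[eps0 epsD] growth GD s ok.
  have M0 := lipschitz_gt0 z0_closest eps0 epsD.
  have [mu0 p1 _ _] := growth.
  apply: (reach_under_growth g_subgradient z0_closest f_lipschitz M0 eps0
    mu0 p1 _ epsD).
  move=> k nX; apply: (growth_of_no_errors f_measurable growth GD _ nX (ok k)).
  exact: pfm_in_ball.
Qed.
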